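(* Let $\Gamma=(V,E)$ be a reduced graph. Then $\gamma(\mathrm{Aut}^{\pi}(\Gamma)) = \mathrm{Aut}^{\pi}(\Gamma)$ and $\gamma$ is a group automorphism of $\mathrm{Aut}^{\pi}(\Gamma)$. Furthermore $\gamma^2 = \mathrm{Id}$, the set of fixed points of $\gamma$ equals $\mathrm{Aut}(\Gamma)$, and for all $\pi\in\mathrm{Aut}^{\pi}(\Gamma)$ and all $v,w\in V$: $$(v,w)\in E \iff (\pi(v),\gamma(\pi)(w))\in E.$$
   Context: Graphs are finite, simple, loopless; $N(v)=\{w:(v,w)\in E\}$; $\Gamma$ is reduced if $N(v)=N(w)$ implies $v=w$. $\mathrm{Aut}^{\pi}(\Gamma)$ is the group of bijections $\pi:V\to V$ such that for every $v$ there exists $w$ with $\pi(N(v))=N(w)$. For $\pi\in\mathrm{Aut}^{\pi}(\Gamma)$, $\gamma(\pi)$ is the permutation of $V$ sending $v$ to the unique $w$ with $N(w)=\pi(N(v))$. *)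

(* Defs.v *)
From HB Require Import structures.
From mathcomp Require Import all_boot all_fingroup.

Set Implicit Arguments.
Unset Strict Implicit.
Unset Printing Implicit Defensive.

(* A finite simple graph is a symmetric irreflexive relation E on a finType V;
   the two hypotheses are assumed where they are needed. *)

Section Graph.
Variables (V : finType) (E : rel V).

Definition nbhd (v : V) : {set V} := [set w | E v w].

Definition reduced : Prop := forall v w, nbhd v = nbhd w -> v = w.

Definition graph_aut : {set {perm V}} :=
  [set p : {perm V} | [forall v, forall w, E (p v) (p w) == E v w]].

Definition aut_pi : {set {perm V}} :=
  [set p : {perm V} | [forall v, exists w, p @: nbhd v == nbhd w]].

Lemma aut_piP (p : {perm V}) :
  reflect (forall v, exists w, p @: nbhd v = nbhd w) (p \in aut_pi).
Proof.
rewrite inE; apply: (iffP forallP) => H v; first by have /existsP[w /eqP] := H v; exists w.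
by have [w Hw] := H v; apply/existsP; exists w; apply/eqP.
Qed.

Lemma aut_pi_group_set : group_set aut_pi.
Proof.
apply/group_setP; split=> [|p q /aut_piP Hp /aut_piP Hq]; apply/aut_piP => v.
  by exists v; rewrite (eq_imset _ (@perm1 V)) imset_id.
have [w Hw] := Hp v; have [u Hu] := Hq w; exists u.
by rewrite (eq_imset _ (permM p q)) imset_comp Hw Hu.
Qed.

Canonical aut_pi_group := Group aut_pi_group_set.

(* gamma p is the permutation q such that, for every v, q v is the vertex w
   with N(w) = p(N(v)). The default value 1 is taken only outside the intended
   domain: see gammaP and gamma_uniq for E reduced and p in aut_pi. *)
Definition gamma (p : {perm V}) : {perm V} :=
  odflt 1%g [pick q : {perm V} | [forall v, nbhd (q v) == p @: nbhd v]].

Lemma gammaP (p : {perm V}) :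
  reduced -> p \in aut_pi -> forall v, nbhd (gamma p v) = p @: nbhd v.
Proof.
move=> redE /aut_piP Hp; rewrite /gamma.
case: pickP => [q /forallP Hq v | no_q]; first exact/eqP.
have Hp' v : exists w, nbhd w == p @: nbhd v.
  by have [w ->] := Hp v; exists w.
pose f v := xchoose (Hp' v).
have Hf v : nbhd (f v) = p @: nbhd v by apply/eqP/(xchooseP (Hp' v)).
have f_inj : injective f.
  move=> v w eq_f; apply: redE; apply: (imset_inj (@perm_inj _ p)).
  by rewrite -!Hf eq_f.
by have /negP[] := negbT (no_q (perm f_inj)); apply/forallP => v; rewrite permE Hf.
Qed.

Lemma gamma_uniq (p : {perm V}) (v w : V) :
  reduced -> p \in aut_pi -> nbhd w = p @: nbhd v -> w = gamma p v.
Proof. by move=> redE Hp Hw; apply: (redE); rewrite gammaP. Qed.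

End Graph.

(* Main.v *)
(* Since E is symmetric, N(gamma p (w)) = p(N(w)) for all w says that E v w and
   E (p v) (gamma p w) are equivalent for all v and w. Exchanging v and w, this
   condition on the pair (p, gamma p) is symmetric, so gamma p is again in
   Aut^pi and gamma (gamma p) = p. *)
Require Import Defs.
From HB Require Import structures.
From mathcomp Require Import all_boot all_fingroup.

Section Gamma.
Variables (V : finType) (E : rel V).

Lemma gamma_adj (p : {perm V}) (v w : V) :
  symmetric E -> reduced E -> p \in aut_pi E -> E (p v) (gamma E p w) = E v w.
Proof.
move=> Esym Ered Hp; rewrite Esym [RHS]Esym.
have := mem_imset (nbhd E w) v (@perm_inj _ p).
by rewrite -gammaP // !inE.
Qed.

Lemma adj_nbhd (p q : {perm V}) (w : V) :
  symmetric E -> (forall v w, E (p v) (q w) = E v w) ->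
  p @: nbhd E w = nbhd E (q w).
Proof.
(* Surjectivity of [p] lets every candidate neighbour be written as an image under [p], where the
   hypothesis applies. *)
move=> Esym Epq; apply/setP=> x; rewrite -[x](permKV p).
by rewrite (mem_imset _ _ (@perm_inj _ p)) !inE Esym -Epq Esym.
Qed.

Lemma adj_aut_pi (p q : {perm V}) :
  symmetric E -> (forall v w, E (p v) (q w) = E v w) -> p \in aut_pi E.
Proof. by move=> Esym Epq; apply/aut_piP=> v; exists (q v); apply: adj_nbhd. Qed.

(** Used below to compute values of [gamma]: it suffices to exhibit a [q] paired with [p] by the
    adjacency relation, and membership of [p] in [aut_pi E] then comes for free. *)
Lemma adj_gamma (p q : {perm V}) :
  symmetric E -> reduced E -> (forall v w, E (p v) (q w) = E v w) ->
  gamma E p = q.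
Proof.
move=> Esym Ered Epq; apply/permP=> v; apply/esym/gamma_uniq => //.
  exact: adj_aut_pi Epq.
by rewrite (adj_nbhd p q).
Qed.

Lemma gamma_adjC (p : {perm V}) (v w : V) :
  symmetric E -> reduced E -> p \in aut_pi E -> E (gamma E p v) (p w) = E v w.
Proof. by move=> Esym Ered Hp; rewrite Esym gamma_adj // Esym. Qed.

Lemma gamma_aut_pi (p : {perm V}) :
  symmetric E -> reduced E -> p \in aut_pi E -> gamma E p \in aut_pi E.
Proof.
by move=> Esym Ered Hp; apply: (@adj_aut_pi _ p) => // v w; apply: gamma_adjC.
Qed.

Lemma gammaK (p : {perm V}) :
  symmetric E -> reduced E -> p \in aut_pi E -> gamma E (gamma E p) = p.
Proof.
by move=> Esym Ered Hp; apply: adj_gamma => // v w; apply: gamma_adjC.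
Qed.

Lemma gammaM (p q : {perm V}) :
  symmetric E -> reduced E -> p \in aut_pi E -> q \in aut_pi E ->
  gamma E (p * q)%g = (gamma E p * gamma E q)%g.
Proof.
(* Adjacency relations compose: the one for [q] is applied at [p v] and [gamma E p w], then the one
   for [p]. *)
by move=> Esym Ered Hp Hq; apply: adj_gamma => // v w; rewrite !permM !gamma_adj.
Qed.

Lemma graph_autP (p : {perm V}) :
  reflect (forall v w, E (p v) (p w) = E v w) (p \in graph_aut E).
Proof.
rewrite inE; apply: (iffP forallP) => [Hp v w|Hp v].
  by have /forallP/(_ w)/eqP := Hp v.
by apply/forallP=> w; apply/eqP.
Qed.

End Gamma.

Theorem theorem2p2 (V : finType) (E : rel V)
    (Esym : symmetric E) (Eirr : irreflexive E) (Ered : reduced E) :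
  [/\ gamma E @: aut_pi E = aut_pi E,
      exists2 f : {perm {perm V}},
        f \in Aut (aut_pi E) & {in aut_pi E, gamma E =1 f},
      {in aut_pi E, forall p, gamma E (gamma E p) = p},
      [set p in aut_pi E | gamma E p == p] = graph_aut E
    & {in aut_pi E, forall (p : {perm V}) (v w : V),
        E v w <-> E (p v) (gamma E p w)}].
Proof.
have gK : {in aut_pi E, cancel (gamma E) (gamma E)}.
  by move=> p Hp; apply: gammaK.
have g_im : gamma E @: aut_pi E = aut_pi E.
  apply/setP=> p; apply/imsetP/idP=> [[q Hq ->]|Hp]; first exact: gamma_aut_pi.
  by exists (gamma E p); rewrite ?gK ?gamma_aut_pi.
split=> //.
- have g_inj := can_in_inj gK.
  have g_sub : gamma E @: aut_pi E \subset aut_pi E by rewrite g_im.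
  (* Elements of [Aut] permute the whole type [{perm V}] and fix everything outside the group, so
     [gamma E] is restricted to [aut_pi E] and extended by the identity. *)
  exists (perm_in g_inj g_sub); last by move=> p Hp; rewrite perm_inE.
  rewrite inE perm_in_on; apply/morphicP=> p q Hp Hq.
  by rewrite !perm_inE ?gammaM // groupM.
(* Preserving [E] is exactly the adjacency relation for the pair [(p, p)]. *)
- apply/setP=> p; rewrite inE; apply/andP/graph_autP=> [[Hp /eqP gp] v w|Hp].
    by rewrite -{2}gp gamma_adj.
  by split; [apply: adj_aut_pi Hp | apply/eqP/adj_gamma].
- by move=> p Hp v w; rewrite gamma_adj.
Qed.
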